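(* Let $n\ge 1$ be any natural number and let $r>0$ be a real number. Then the function $g:\mathbb{R}^n\to\mathbb{R}$, $$g(x)=\frac{1-\|x\|^r}{1-\|x\|},$$ is conditionally negative definite on $\mathbb{R}^n$ if and only if $1\le r\le 3$. As a consequence, for $1\le r\le 3$ the function $f:\mathbb{R}^n\to\mathbb{R}$, $$f(x)=\frac{1-\|x\|}{1-\|x\|^r},$$ is infinitely divisible on $\mathbb{R}^n$.
   Context: $\|\cdot\|$ is the Euclidean norm on $\mathbb{R}^n$. Convention: when $\|x\|=1$, the quotients are interpreted as their limiting values, i.e. $f(x)=1/r$ and $g(x)=r$. Definitions. An $m\times m$ real symmetric matrix $A$ is positive semidefinite if $\langle v,Av\rangle\ge 0$ for all $v\in\mathbb{R}^m$; it is conditionally positive definite if $\langle v,Av\rangle\ge 0$ for all $v\in\mathbb{R}^m$ with $\sum_j v_j=0$; it is conditionally negative definite if $-A$ is conditionally positive definite. A continuous function $h:\mathbb{R}^n\to\mathbb{R}$ is called positive definite (resp. conditionally negative definite) if for every $m\ge 1$ and every choice of points $x_1,\dots,x_m\in\mathbb{R}^n$ the $m\times m$ matrix $[h(x_i-x_j)]$ is positive semidefinite (resp. conditionally negative definite). A nonnegative function $h$ on $\mathbb{R}^n$ is called infinitely divisible if for every real $\alpha>0$ the function $h(x)^\alpha$ is positive definite. *)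

(* Defs.v *)
From HB Require Import structures.
From mathcomp Require Import all_boot all_order all_algebra.
From mathcomp Require Import all_classical all_reals all_analysis.
Set Implicit Arguments.
Unset Strict Implicit.
Unset Printing Implicit Defensive.
Import Order.TTheory GRing.Theory Num.Theory.
Import numFieldNormedType.Exports.

Local Open Scope classical_set_scope.
Local Open Scope ring_scope.

(* The norm [`|x|] on ['rV[R]_n] is the sup norm, hence this definition; both
   norms induce the same topology, so [continuous] below is the usual notion. *)
Definition enorm (R : realType) (n : nat) (x : 'rV[R]_n) : R :=
  Num.sqrt (\sum_(i < n) x 0 i ^+ 2).

Definition quad_form (R : realType) (m : nat) (A : 'M[R]_m) (v : 'cV[R]_m) : R :=
  (v^T *m (A *m v)) 0 0.

Definition psdmx (R : realType) (m : nat) (A : 'M[R]_m) : Prop :=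
  A \is symmetricmx /\ forall v : 'cV[R]_m, 0 <= quad_form A v.

Definition cpdmx (R : realType) (m : nat) (A : 'M[R]_m) : Prop :=
  A \is symmetricmx /\
  forall v : 'cV[R]_m, \sum_(j < m) v j 0 = 0 -> 0 <= quad_form A v.

Definition cndmx (R : realType) (m : nat) (A : 'M[R]_m) : Prop := cpdmx (- A).

Definition diff_mx (R : realType) (n m : nat) (h : 'rV[R]_n -> R)
    (x : 'I_m -> 'rV[R]_n) : 'M[R]_m :=
  \matrix_(i, j) h (x i - x j).

Definition positive_definite (R : realType) (n : nat) (h : 'rV[R]_n -> R) : Prop :=
  continuous h /\
  forall (m : nat) (x : 'I_m -> 'rV[R]_n), (1 <= m)%N -> psdmx (diff_mx h x).

Definition cond_negative_definite (R : realType) (n : nat)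
    (h : 'rV[R]_n -> R) : Prop :=
  continuous h /\
  forall (m : nat) (x : 'I_m -> 'rV[R]_n), (1 <= m)%N -> cndmx (diff_mx h x).

Definition infinitely_divisible (R : realType) (n : nat)
    (h : 'rV[R]_n -> R) : Prop :=
  (forall x, 0 <= h x) /\
  forall alpha : R, 0 < alpha -> positive_definite (fun x => h x `^ alpha).

(* At [enorm x = 1] both quotients take their limiting value. *)
Definition g_fun (R : realType) (n : nat) (r : R) (x : 'rV[R]_n) : R :=
  if enorm x == 1 then r else (1 - enorm x `^ r) / (1 - enorm x).

Definition f_fun (R : realType) (n : nat) (r : R) (x : 'rV[R]_n) : R :=
  if enorm x == 1 then r^-1 else (1 - enorm x) / (1 - enorm x `^ r).

(* Main.v *)
Require Import Defs.
From mathcomp Require Import all_boot all_order all_algebra.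
From mathcomp Require Import ring lra.
From mathcomp Require Import all_classical all_reals all_analysis.
Import Order.TTheory GRing.Theory Num.Theory.
Import numFieldNormedType.Exports.
Local Open Scope classical_set_scope.
Local Open Scope ring_scope.
Set Implicit Arguments.
Unset Strict Implicit.
Unset Printing Implicit Defensive.

(** Write [t = |x|] and [G_r(t) = (1 - t^r) / (1 - t)], which is [divdiff r t].

    Sufficiency rests on one algebraic fact ([cnd_inv_psd]): if [h] is
    a positive conditionally negative definite kernel, then [1 / h] is positive
    semidefinite.  Hence [h / (h + l)] is again conditionally negative definite
    for [l > 0] ([cnd_resolvent]), and so is every limit of positive
    combinations of such kernels.  For [0 < s < 1] the power [t^s] is such a
    limit of combinations of the functions [t / (t + l)], by Loewner's formula,
    which expresses [t^s] as a multiple of the integral of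
    [l^(s-1) * t / (t + l)] over [l > 0].  In place of the integral,
    [loewner_power] uses sums over the geometric mesh [l = q^k]: a dilation by
    [q] multiplies such a sum by exactly [q^s] up to two boundary terms, so,
    once normalized at [t = 1], the sum agrees with [t^s] at the powers of [q] in
    the limit, and monotonicity controls it in between.

    - Multiplying the formula by [t] and forming difference quotients at [1]
      writes [G_(1+s)] as a limit of positive combinations of
      [t / (t + l) + l / ((1 + l) (t + l))], which are increasing affine
      functions of [t / (t + l)]; so [G_r(h)] is conditionally negative definite whenever
      [h >= 0] is, for [1 <= r <= 2] ([cnd_divdiff_1_2]).
    - For [2 < r < 3], [G_(2+s) = 1 + t * G_(1+s)] leads to the terms
      [t^2 / (t + l)], which are no longer Bernstein functions of [t].  They are
      handled as functions of [h = t^2], the squared distance, which is itself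
      conditionally negative definite: [h / (sqrt h + l) + l] is the difference
      quotient of [u^(3/2)] between [h] and [l^2], that is
      [l * G_(3/2)(h / l^2)], and the first item applies
      ([cnd_sqrt_resolvent], [cnd_divdiff_sqrt]).
    - For infinite divisibility, [g^(-a) = (1 / g^(a/N))^N] with [a/N <= 1]:
      the power [g^(a/N)] is conditionally negative definite, its reciprocal is
      positive semidefinite, and Schur's product theorem gives the [N]-th power.
    - Conversely, conditional negative definiteness forces [g(0) <= g(x)], which
      fails for [r < 1] at [|x| = 1]; and, tested at [0, x, 2x] with weights
      [1, -2, 1], it forces at most quadratic growth, whereas [G_r] grows like
      [t^(r-1)]. *)

(** * Positive semidefinite and conditionally negative definite kernels *)

Definition qform (R : pzRingType) (I : finType) (K : I -> I -> R) (v : I -> R) : R :=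
  \sum_i \sum_j v i * v j * K i j.

(** Functions of two indices, rather than matrices, because all constructions
    below act entrywise. *)
Definition psd (R : numDomainType) (I : finType) (K : I -> I -> R) : Prop :=
  (forall i j, K i j = K j i) /\ forall v, 0 <= qform K v.

Definition cnd (R : numDomainType) (I : finType) (K : I -> I -> R) : Prop :=
  (forall i j, K i j = K j i) /\
  forall v, \sum_i v i = 0 -> qform K v <= 0.

Section Kernels.
Variables (R : rcfType) (I : finType).
Implicit Types (K L h : I -> I -> R) (v w : I -> R).

Lemma eq_qform K L v : (forall i j, K i j = L i j) -> qform K v = qform L v.
Proof. by move=> e; apply: eq_bigr => i _; apply: eq_bigr => j _; rewrite e. Qed.

Lemma eq_psd K L : (forall i j, K i j = L i j) -> psd K -> psd L.
Proof.
move=> e [sK pK]; split=> [i j|v]; first by rewrite -!e.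
by rewrite -(eq_qform v e).
Qed.

Lemma eq_cnd K L : (forall i j, K i j = L i j) -> cnd K -> cnd L.
Proof.
move=> e [sK pK]; split=> [i j|v v0]; first by rewrite -!e.
by rewrite -(eq_qform v e) pK.
Qed.

Lemma sum_delta (i0 : I) (F : I -> R) : \sum_i (i == i0)%:R * F i = F i0.
Proof.
rewrite (bigD1 i0) //= eqxx mul1r big1 ?addr0 // => i /negbTE ->.
by rewrite mul0r.
Qed.

Lemma qformD K L v : qform (fun i j => K i j + L i j) v = qform K v + qform L v.
Proof.
rewrite /qform -big_split; apply: eq_bigr => i _; rewrite -big_split.
by apply: eq_bigr => j _; rewrite mulrDr.
Qed.

Lemma qformZ a K v : qform (fun i j => a * K i j) v = a * qform K v.
Proof.
rewrite /qform mulr_sumr; apply: eq_bigr => i _; rewrite mulr_sumr.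
by apply: eq_bigr => j _; rewrite mulrCA.
Qed.

Lemma qform_rank1 w v : qform (fun i j => w i * w j) v = (\sum_i v i * w i) ^+ 2.
Proof.
rewrite expr2 mulr_suml; apply: eq_bigr => i _; rewrite mulr_sumr.
by apply: eq_bigr => j _; rewrite mulrACA.
Qed.

Lemma qform_row (f : I -> R) v :
  qform (fun i _ => f i) v = (\sum_i v i) * \sum_i v i * f i.
Proof.
rewrite mulrC mulr_suml; apply: eq_bigr => i _; rewrite mulr_sumr.
by apply: eq_bigr => j _; ring.
Qed.

Lemma qform_col (f : I -> R) v :
  qform (fun _ j => f j) v = (\sum_i v i) * \sum_i v i * f i.
Proof.
rewrite mulr_suml; apply: eq_bigr => i _; rewrite mulr_sumr.
by apply: eq_bigr => j _; ring.
Qed.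

Lemma qform_sum_rank1 (T : Type) (s : seq T) (w : T -> I -> R) L v :
  qform (fun i j => (\sum_(k <- s) w k i * w k j) * L i j) v =
  \sum_(k <- s) qform L (fun i => v i * w k i).
Proof.
symmetry; rewrite /qform exchange_big /=; apply: eq_bigr => i _.
rewrite exchange_big /=; apply: eq_bigr => j _.
rewrite mulr_suml mulr_sumr; apply: eq_bigr => k _; by ring.
Qed.

(** Moving the value at a single index is the only change of test vector used
    below: it completes squares and restores the zero-sum condition. *)
Lemma qform_shift K v a i0 : (forall i j, K i j = K j i) ->
  qform K (fun i => v i - a * (i == i0)%:R) =
  qform K v - a * (\sum_i v i * K i i0) *+ 2 + a ^+ 2 * K i0 i0.
Proof.
move=> sK.
have -> : qform K (fun i => v i - a * (i == i0)%:R) =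
  \sum_i (\sum_j v i * v j * K i j
    - a * \sum_j (j == i0)%:R * (v i * K i j)
    - a * ((i == i0)%:R * \sum_j (v j * K i j))
    + a ^+ 2 * ((i == i0)%:R * \sum_j (j == i0)%:R * K i j)).
  apply: eq_bigr => i _; rewrite !mulr_sumr -!sumrN -!big_split /=.
  by apply: eq_bigr => j _; ring.
under eq_bigr do rewrite !sum_delta.
rewrite !big_split /= !sumrN -!mulr_sumr !sum_delta.
have -> : \sum_j v j * K i0 j = \sum_i v i * K i i0.
  by apply: eq_bigr => j _; rewrite sK.
rewrite /qform; ring.
Qed.

Lemma qform_delta K i0 : (forall i j, K i j = K j i) ->
  qform K (fun i => (i == i0)%:R) = K i0 i0.
Proof.
move=> sK; transitivity (qform K (fun i => 0 - (-1) * (i == i0)%:R)).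
  by apply: eq_bigr => i _; apply: eq_bigr => j _; rewrite !sub0r !mulN1r !opprK.
rewrite qform_shift //.
have -> : qform K (fun _ => 0) = 0.
  by rewrite /qform big1 // => i _; rewrite big1 // => j _; rewrite !mul0r.
by rewrite big1 ?mulr0 ?mul0rn => [|i _]; rewrite ?mul0r //; ring.
Qed.

Lemma psd_diag_ge0 K i : psd K -> 0 <= K i i.
Proof. by case=> sK pK; rewrite -(qform_delta i sK). Qed.

(** Otherwise the form would be affine and not constant, hence negative somewhere,
    along a line in the direction of the index [i]. *)
Lemma psd_diag_eq0 K i j : psd K -> K i i = 0 -> K i j = 0.
Proof.
move=> [sK pK] Kii; apply/eqP; apply: contraT => nz.
(* this [a] makes the value of the form equal to -1 *)
pose c := K i j; pose a : R := (K j j + 1) / (2 * c).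
have := pK (fun k => (k == j)%:R - a * (k == i)%:R).
rewrite qform_shift // qform_delta // Kii sum_delta mulr0 addr0 (sK j i) -/c.
have -> : K j j - a * c *+ 2 = -1 by rewrite /a; field.
by rewrite oppr_ge0 ler10.
Qed.

(** Minimizing the form over the value of the test vector at [i0] leaves the form
    of the Schur complement. *)
Lemma schur_complement_psd K i0 : psd K -> K i0 i0 != 0 ->
  psd (fun i j => K i j - K i i0 * K j i0 / K i0 i0).
Proof.
move=> [sK pK] nz; split=> [i j|v]; first by rewrite (sK i j) (mulrC (K i i0)).
pose b := \sum_i v i * K i i0.
have -> : qform (fun i j => K i j - K i i0 * K j i0 / K i0 i0) v
  = qform K v - b ^+ 2 / K i0 i0.
  rewrite -(qform_rank1 (fun i => K i i0)) [_ / _]mulrC -mulNr -qformZ -qformD.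
  by apply: eq_qform => i j; rewrite mulNr [_^-1 * _]mulrC.
have := pK (fun i => v i - b / K i0 i0 * (i == i0)%:R).
rewrite qform_shift // -/b; congr (_ <= _); by field.
Qed.

(** Cholesky decomposition: splitting off a Schur complement kills one nonzero
    diagonal entry and creates none, so the number of these decreases. *)
Lemma psd_sum_rank1 K : psd K ->
  exists s : seq (I -> R), forall i j, K i j = \sum_(w <- s) w i * w j.
Proof.
have [n] := ubnP #|[pred i | K i i != 0]|; elim: n K => // n IH K leKn pK.
have [i0 nz|none] := pickP (fun i => K i i != 0); last first.
  exists [::] => i j; rewrite big_nil.
  by apply: psd_diag_eq0 => //; apply/eqP/negbFE/(none i).
pose K' i j := K i j - K i i0 * K j i0 / K i0 i0.
have Kpos : 0 < K i0 i0 by rewrite lt_def nz psd_diag_ge0.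
have pK' : psd K' by exact: schur_complement_psd.
have [|s es] := IH K' _ pK'.
  move: leKn; rewrite ltnS; apply: leq_trans; apply: proper_card; apply/properP.
  split; last first.
    by exists i0; rewrite !inE // /K' mulfK ?subrr // negbK.
  apply/fintype.subsetP => i; rewrite !inE; apply: contraNneq => Kii.
  by rewrite /K' Kii (psd_diag_eq0 _ pK Kii) !mul0r subrr.
exists ((fun i => K i i0 / Num.sqrt (K i0 i0)) :: s) => i j.
rewrite big_cons -es /K' mulrACA -invfM -expr2 sqr_sqrtr ?ltW //.
by rewrite addrC subrK.
Qed.

(** Schur's theorem: a rank-one factor only rescales the test vector. *)
Lemma psd_mul K L : psd K -> psd L -> psd (fun i j => K i j * L i j).
Proof.
move=> pK [sL pL]; have [s es] := psd_sum_rank1 pK.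
split=> [i j|v]; first by rewrite pK.1 sL.
rewrite (eq_qform (L := fun i j => (\sum_(w <- s) w i * w j) * L i j)).
  by rewrite (qform_sum_rank1 s (fun w => w)) sumr_ge0.
by move=> i j; rewrite es.
Qed.

Lemma psd_const (a : R) : 0 <= a -> psd (fun _ _ : I => a).
Proof.
move=> a0; split=> // v; rewrite qform_row -mulr_suml mulrA -expr2.
by rewrite mulr_ge0 ?sqr_ge0.
Qed.

Lemma psd_exp K n : psd K -> psd (fun i j => K i j ^+ n).
Proof.
move=> pK; elim: n => [|n IH]; first by apply: eq_psd (psd_const ler01) => i j.
by apply: eq_psd (psd_mul pK IH) => i j; rewrite exprS.
Qed.

Lemma cnd_const (a : R) : cnd (fun _ _ : I => a).
Proof. by split=> // v v0; rewrite qform_row v0 mul0r. Qed.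

Lemma cnd_sqr_dist (a : I -> R) : cnd (fun i j => (a i - a j) ^+ 2).
Proof.
split=> [i j|v v0]; first by rewrite -sqrrN opprB.
rewrite (eq_qform (L := fun i j =>
  a i ^+ 2 + a j ^+ 2 + -2 * (a i * a j))) => [|i j]; last by ring.
rewrite !qformD qformZ qform_rank1 (qform_row (fun i => a i ^+ 2)).
rewrite (qform_col (fun i => a i ^+ 2)) v0 !mul0r !add0r.
by have := sqr_ge0 (\sum_i v i * a i); lra.
Qed.

Lemma psd_cndN K : psd K -> cnd (fun i j => - K i j).
Proof.
move=> [sK pK]; split=> [i j|v _]; first by rewrite sK.
rewrite (eq_qform (L := fun i j => -1 * K i j)) ?qformZ ?mulN1r ?oppr_le0 //.
by move=> i j; rewrite mulN1r.
Qed.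

Lemma cndD K L : cnd K -> cnd L -> cnd (fun i j => K i j + L i j).
Proof.
move=> [sK pK] [sL pL]; split=> [i j|v v0]; first by rewrite sK sL.
by rewrite qformD; have := pK v v0; have := pL v v0; lra.
Qed.

Lemma cndZ a K : 0 <= a -> cnd K -> cnd (fun i j => a * K i j).
Proof.
move=> a0 [sK pK]; split=> [i j|v v0]; first by rewrite sK.
by rewrite qformZ mulr_ge0_le0 ?pK.
Qed.

Lemma cnd_sum (T : Type) (s : seq T) (P : pred T) (K : T -> I -> I -> R) :
  (forall k, P k -> cnd (K k)) -> cnd (fun i j => \sum_(k <- s | P k) K k i j).
Proof.
move=> cK; elim: s => [|k s IH].
  by apply: eq_cnd (cnd_const 0) => i j; rewrite big_nil.
have [Pk|Pk] := boolP (P k).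
  by apply: eq_cnd (cndD (cK k Pk) IH) => i j; rewrite big_cons Pk.
by apply: eq_cnd IH => i j; rewrite big_cons (negbTE Pk).
Qed.

(** The test with weights 1 at [j] and -1 at [i]. *)
Lemma cnd_diag_le h i j : cnd h -> h i i + h j j <= h i j *+ 2.
Proof.
move=> [sh ch].
have : qform h (fun k => (k == j)%:R - 1 * (k == i)%:R) <= 0.
  apply: ch; rewrite big_split /= sumrN.
  under eq_bigr => k _ do rewrite -[_%:R]mulr1.
  under [X in _ - X]eq_bigr => k _ do rewrite mulrC.
  by rewrite !sum_delta subrr.
rewrite qform_shift // qform_delta // sum_delta (sh j i); lra.
Qed.

(** Grounding a conditionally negative definite kernel at a base point: the
    test vector is corrected by a multiple of the base point so that its
    entries sum to zero. *)
Lemma cnd_ground_psd h o : cnd h ->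
  psd (fun i j => h i o + h j o - h i j - h o o).
Proof.
move=> [sh ch]; split=> [i j|v]; first by rewrite (sh i j); ring.
pose a := \sum_i v i.
have : qform h (fun i => v i - a * (i == o)%:R) <= 0.
  apply: ch.
  rewrite big_split /= sumrN -mulr_sumr; under [X in _ * X]eq_bigr => k _ do rewrite -[_%:R]mulr1.
  by rewrite sum_delta mulr1 subrr.
rewrite qform_shift //.
suff -> : qform (fun i j => h i o + h j o - h i j - h o o) v =
  - (qform h v - a * (\sum_i v i * h i o) *+ 2 + a ^+ 2 * h o o).
  by rewrite oppr_ge0.
have e3 : qform (fun _ _ => - h o o) v = - h o o * a ^+ 2.
  by rewrite qform_row -mulr_suml -/a; ring.
have e4 : qform (fun i j => - h i j) v = - qform h v.
  rewrite (eq_qform (L := fun i j => -1 * h i j)) => [|i j]; last by rewrite mulN1r.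
  by rewrite qformZ mulN1r.
by rewrite !qformD (qform_row (h ^~ o)) (qform_col (h ^~ o)) e3 e4 -/a; ring.
Qed.

(** With a base point [o], the Schur complement of [1 / h] at [o] is
    [N i j / (h i o * h j o * h i j)], where
    [N i j = h i o * h j o - h o o * h i j].  The kernel [N] is the sum of a
    rank-one kernel and of [h o o] times the grounded kernel, hence positive
    semidefinite, and it vanishes on the row of [o].  Splitting [N] into rank-one
    terms therefore reduces the claim to test vectors with smaller support. *)
Lemma cnd_inv_psd h : cnd h -> (forall i j, 0 < h i j) ->
  psd (fun i j => (h i j)^-1).
Proof.
move=> ch h0; split=> [i j|v]; first by rewrite ch.1.
have [n] := ubnP #|[pred i | v i != 0]|; elim: n v => // n IH v len.
have [ o nz|none] := pickP (fun i => v i != 0); last first.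
  rewrite /qform big1 // => i _; rewrite big1 // => j _.
  by have /negbFE/eqP -> := none i; rewrite !mul0r.
pose N i j := (h i o - h o o) * (h j o - h o o)
  + h o o * (h i o + h j o - h i j - h o o).
have pN : psd N.
  have [s1 p1] := cnd_ground_psd o ch.
  split=> [i j|w]; first by rewrite /N s1 [X in X + _]mulrC.
  rewrite qformD (qform_rank1 (fun i => h i o - h o o)) qformZ.
  by rewrite addr_ge0 ?sqr_ge0 // mulr_ge0 // ltW.
have [s es] := psd_sum_rank1 pN.
have Noo : \sum_(w <- s) w o * w o = 0 by rewrite -es /N; ring.
have hn i j : h i j != 0 by rewrite gt_eqF.
rewrite (eq_qform (L := fun i j => h o o * ((h i o)^-1 * (h j o)^-1)
   + (\sum_(w <- s) (w i / h i o) * (w j / h j o)) * (h i j)^-1)); last first.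
  move=> i j; under eq_bigr do rewrite mulrACA.
  rewrite -mulr_suml -es /N.
  by field; rewrite !hn.
rewrite qformD qformZ qform_rank1 addr_ge0 //.
  by rewrite mulr_ge0 ?sqr_ge0 // ltW.
rewrite (qform_sum_rank1 s (fun w i => w i / h i o)).
(* [N o o = 0] is a sum of squares, so each rank-one term vanishes at [o] *)
have : all (fun w => w o == 0) s.
  move: Noo => /eqP; elim: (s) => //= w s' IHs; rewrite big_cons.
  rewrite paddr_eq0; last 2 first.
  - by rewrite -expr2 sqr_ge0.
  - by apply: sumr_ge0 => k _; rewrite -expr2 sqr_ge0.
  by rewrite mulf_eq0 orbb => /andP[-> /IHs].
elim: (s) => [|w s' IHs] /=; rewrite ?big_nil ?big_cons // => /andP[/eqP wo /IHs].
apply: addr_ge0; apply: IH; move: len; rewrite ltnS; apply: leq_trans.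
apply: proper_card; apply/properP; split; last first.
  by exists o; rewrite !inE // wo mul0r mulr0 eqxx.
by apply/fintype.subsetP => i; rewrite !inE; apply: contraNneq => ->; rewrite mul0r.
Qed.

(** The quotient is [1 - l / (h + l)]. *)
Lemma cnd_resolvent h l : cnd h -> (forall i j, 0 <= h i j) -> 0 < l ->
  cnd (fun i j => h i j / (h i j + l)).
Proof.
move=> ch h0 l0.
have chl : cnd (fun i j => h i j + l) by apply: cndD => //; exact: cnd_const.
have hl i j : 0 < h i j + l by rewrite ltr_wpDl.
have := cndD (cnd_const 1) (cndZ (ltW l0) (psd_cndN (cnd_inv_psd chl hl))).
apply: eq_cnd => i j; field; exact: lt0r_neq0.
Qed.
End Kernels.

Lemma cvg_ext (R : realType) (T : Type) (F : set_system T) (f g : T -> R) (l : R) :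
  f =1 g -> f @ F --> l -> g @ F --> l.
Proof. by move=> /funext ->. Qed.

(** * Powers as limits of sums of resolvents *)

Section GeometricSums.
Variables (R : realType).
Implicit Types (p q t a : R) (K : nat).

(** With [p = q^s], this is, up to a factor that does not depend on [t] and
    cancels in [geomratio], the Riemann sum on the mesh [q^j], [-K <= j <= K], of
    the integral of [l^s * t / (t + l)] against [dl / l]. *)
Definition geomsum p q K t : R :=
  \sum_(k < K.*2.+1) p ^+ k * (t / (t + q ^+ k / q ^+ K)).

Definition geomratio p q K t : R := geomsum p q K t / geomsum p q K 1.

Lemma geomsum_mono p q K s t : 0 <= p -> 0 < q -> 0 <= s -> s <= t ->
  geomsum p q K s <= geomsum p q K t.
Proof.
move=> p0 q0 s0 st; apply: ler_sum => k _; apply: ler_wpM2l; first exact: exprn_ge0.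
have l0 : 0 < q ^+ k / q ^+ K by rewrite divr_gt0 ?exprn_gt0.
have sl : 0 < s + q ^+ k / q ^+ K by rewrite ltr_wpDl.
have tl : 0 < t + q ^+ k / q ^+ K by rewrite ltr_wpDl // (le_trans s0).
rewrite ler_pdivrMr // mulrAC ler_pdivlMr //.
move: (_ / _) l0 sl tl => l l0 sl tl; nra.
Qed.

(** The middle term [k = K] alone gives the bound. *)
Lemma geomsum1_ge p q K : 0 <= p -> 0 < q -> p ^+ K / 2 <= geomsum p q K 1.
Proof.
move=> p0 q0; have Kl : (K < K.*2.+1)%N by rewrite ltnS -addnn leq_addr.
rewrite /geomsum (bigD1 (Ordinal Kl)) //=.
rewrite divff ?expf_neq0 ?gt_eqF // mul1r -[X in X <= _]addr0 lerD //.
apply: sumr_ge0 => i _; rewrite mulr_ge0 ?exprn_ge0 // divr_ge0 //.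
by rewrite addr_ge0 // divr_ge0 ?exprn_ge0 // ltW.
Qed.

Lemma geomsum1_gt0 p q K : 0 < p -> 0 < q -> 0 < geomsum p q K 1.
Proof.
move=> p0 q0; apply: lt_le_trans (geomsum1_ge _ (ltW p0) q0).
by rewrite divr_gt0 ?exprn_gt0.
Qed.

Lemma geomratio_mono p q K s t : 0 <= p -> 0 < q -> 0 <= s -> s <= t ->
  geomratio p q K s <= geomratio p q K t.
Proof.
move=> p0 q0 s0 st; rewrite ler_wpM2r ?geomsum_mono // invr_ge0.
by apply: le_trans (geomsum1_ge _ p0 q0); rewrite divr_ge0 ?exprn_ge0.
Qed.

(** Dilating by the ratio [q] shifts the index, so only two boundary terms
    spoil the homogeneity [A (q t) = p A t]. *)
Lemma geomsum_dilate p q K t : 0 < q -> 0 < t ->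
  geomsum p q K (q * t) = p * geomsum p q K t
    + t / (t + q^-1 / q ^+ K) - p ^+ K.*2.+1 * (t / (t + q ^+ K)).
Proof.
move=> q0 t0; rewrite /geomsum big_ord_recl big_ord_recr /=.
have qn0 : q != 0 by rewrite gt_eqF.
have qK k : 0 < q ^+ k by rewrite exprn_gt0.
have -> : q ^+ K.*2 / q ^+ K = q ^+ K by rewrite -addnn exprD mulfK ?gt_eqF.
have -> : p ^+ 0 * (q * t / (q * t + q ^+ 0 / q ^+ K)) = t / (t + q^-1 / q ^+ K).
  have -> : q * t + q ^+ 0 / q ^+ K = q * (t + q^-1 / q ^+ K).
    by rewrite expr0 mulrDr mulrA divff.
  by rewrite expr0 mul1r -mulf_div divff // mul1r.
have -> : \sum_(i < K.*2) p ^+ bump 0 i * (q * t / (q * t + q ^+ bump 0 i / q ^+ K))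
   = p * \sum_(i < K.*2) p ^+ i * (t / (t + q ^+ i / q ^+ K)).
  rewrite mulr_sumr; apply: eq_bigr => i _.
  rewrite /bump leq0n add1n !exprS.
  have -> : q * t + q * q ^+ i / q ^+ K = q * (t + q ^+ i / q ^+ K) by rewrite mulrDr !mulrA.
  by rewrite -mulf_div divff // mul1r mulrA.
rewrite exprS; ring.
Qed.

Lemma geomratio1 p q K : 0 < p -> 0 < q -> geomratio p q K 1 = 1.
Proof.
by move=> p0 q0; rewrite /geomratio divff // gt_eqF // geomsum1_gt0.
Qed.

(** After normalization the two boundary terms are of order [p^-K] and
    [(p / q)^K]. *)
Lemma geomratio_dilate p q t : 1 < p -> p < q -> 0 < t ->
  (fun K => geomratio p q K (q * t) - p * geomratio p q K t) @ \oo --> 0.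
Proof.
move=> p1 pq t0.
have p0 : 0 < p by lra.
have q0 : 0 < q by lra.
pose b K : R := 2 * (p^-1) ^+ K + 2 * p * t * (p / q) ^+ K.
have b0 : b @ \oo --> 0.
  have c1 : (fun K => (p^-1) ^+ K) @ \oo --> (0 : R).
    by apply: cvg_expr; rewrite gtr0_norm ?invr_gt0 // invf_lt1.
  have c2 : (fun K => (p / q) ^+ K) @ \oo --> (0 : R).
    by apply: cvg_expr; rewrite gtr0_norm ?divr_gt0 // ltr_pdivrMr // mul1r.
  have := cvgD (cvgM (cvg_cst (2 : R)) c1) (cvgM (cvg_cst (2 * p * t)) c2).
  by rewrite !mulr0 addr0; apply.
apply/cvgr0Pnorm_le => e e0.
have /cvgr0Pnorm_le/(_ e e0) := b0.
apply: filterS => K; apply: le_trans.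
rewrite [X in _ <= X]ger0_norm; last first.
  by rewrite addr_ge0 // !mulr_ge0 ?exprn_ge0 ?divr_ge0 ?invr_ge0 // ltW.
have S1 := geomsum1_ge K (ltW p0) q0.
have pK : 0 < p ^+ K / 2 by rewrite divr_gt0 ?exprn_gt0.
have S0 : 0 < geomsum p q K 1 by exact: geomsum1_gt0.
have -> : geomratio p q K (q * t) - p * geomratio p q K t =
   (t / (t + q^-1 / q ^+ K) - p ^+ K.*2.+1 * (t / (t + q ^+ K))) / geomsum p q K 1.
  by rewrite /geomratio geomsum_dilate //; ring.
rewrite normrM [`|_^-1|]gtr0_norm ?invr_gt0 //.
have x0 : 0 < q^-1 / q ^+ K by rewrite divr_gt0 ?invr_gt0 ?exprn_gt0.
have qK : 0 < q ^+ K by rewrite exprn_gt0.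
apply: (@le_trans _ _ ((1 + p ^+ K.*2.+1 * (t / q ^+ K)) / (p ^+ K / 2))).
  apply: ler_pM => //; rewrite ?invr_ge0 ?(ltW S0) //; last by rewrite lef_pV2 ?posrE.
  apply: le_trans (ler_normB _ _) _; apply: lerD.
    rewrite ger0_norm ?divr_ge0 ?ler_pdivrMr ?addr_gt0 ?addr_ge0 ?(ltW t0) ?(ltW x0) //.
    by rewrite mul1r lerDl ltW.
  rewrite ger0_norm; last first.
    by rewrite mulr_ge0 ?exprn_ge0 ?divr_ge0 ?addr_ge0 // ltW.
  rewrite ler_wpM2l ?exprn_ge0 ?(ltW p0) // ler_wpM2l ?(ltW t0) //.
  by rewrite lef_pV2 ?posrE ?addr_gt0 // lerDr ltW.
rewrite /b exprMn !exprVn exprS -addnn exprD.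
rewrite le_eqVlt; apply/orP; left; apply/eqP; field.
by rewrite !gt_eqF ?exprn_gt0.
Qed.

Lemma powRS_int p (i : int) : 0 < p -> p `^ (i + 1)%:~R = p * p `^ i%:~R.
Proof.
move=> p0; rewrite intrD powRD ?powRr1 1?mulrC ?ltW //.
by rewrite (gt_eqF p0) implybT.
Qed.

Lemma geomratio_powq p q (j : int) : 1 < p -> p < q ->
  (fun K => geomratio p q K (q `^ j%:~R)) @ \oo --> p `^ j%:~R.
Proof.
move=> p1 pq.
have p0 : 0 < p by lra.
have q0 : 0 < q by lra.
have qj (i : int) := powRS_int i q0.
have pj (i : int) := powRS_int i p0.
have dil (i : int) := geomratio_dilate p1 pq (powR_gt0 i%:~R q0).
elim/int_rect: j => [|n IH|n IH].
- rewrite !powRr0; under eq_fun do rewrite geomratio1 //.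
  exact: cvg_cst.
- rewrite -addn1 PoszD qj pj.
  rewrite -[X in _ --> X]add0r; apply: cvg_ext (_ : _ --> _) => [K|]; last first.
    by apply: cvgD (dil n) _; apply: cvgM; [exact: cvg_cst | exact: IH].
  by rewrite /= subrK.
- have e : - n%:Z = - n.+1%:Z + 1 by rewrite -addn1 PoszD opprD subrK.
  rewrite e qj pj in IH.
  rewrite -[X in _ --> X](mulKf (lt0r_neq0 p0)) -[p * _]subr0.
  apply: cvg_ext (_ : _ --> _) => [K|]; last first.
    apply: cvgM; first exact: cvg_cst.
    by apply: cvgB IH _; exact: (dil (- n.+1%:Z)).
  by rewrite /= opprB addrC subrK mulKf ?gt_eqF.
Qed.

(** Bracketing [t] between consecutive powers of [q] costs a factor [p]. *)
Lemma geomratio_near p s t e : 1 < p -> 0 < s < 1 -> 0 <= t -> 0 < e ->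
  \forall K \near \oo,
    `|geomratio p (p `^ s^-1) K t - t `^ s| <= (p - 1) * t `^ s + e.
Proof.
move=> p1 /andP[s0 s1]; rewrite le_eqVlt => /predU1P[<-|t0] e0.
  near=> K; rewrite /geomratio /geomsum big1 => [|i _]; last by rewrite mul0r mulr0.
  by rewrite powR0 ?gt_eqF // mul0r subr0 normr0 mulr0 add0r ltW.
have p0 : 0 < p by lra.
set q := p `^ s^-1.
have pq : p < q.
  rewrite /q /powR gt_eqF // -{1}(lnK p0) ltr_expR.
  by rewrite -[ltLHS]mul1r ltr_pM2r ?ln_gt0 // invf_gt1.
have q0 : 0 < q by lra.
have qs : q `^ s = p by rewrite /q -powRrM mulVf ?gt_eqF // powRr1 // ltW.
pose j := Num.floor (ln t / ln q).
have lnq : 0 < ln q by rewrite ln_gt0 //; lra.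
have tq : t = q `^ (ln t / ln q).
  by rewrite /powR gt_eqF // mulfVK ?gt_eqF // lnK ?posrE.
have q1 : 1 <= q by lra.
have lt : q `^ j%:~R <= t by rewrite [leRHS]tq; apply: ler_powR => //; exact: Num.Theory.floor_le.
have tu : t <= q `^ (j + 1)%:~R by rewrite [leLHS]tq; apply: ler_powR => //; apply/ltW/Num.Theory.floorD1_gt.
have lt' : p `^ j%:~R <= t `^ s.
  rewrite -qs -powRrM mulrC powRrM.
  by apply: ge0_ler_powR; rewrite ?nnegrE ?powR_ge0 ?(ltW s0) ?(ltW t0).
have tu' : t `^ s <= p `^ (j + 1)%:~R.
  rewrite -qs -powRrM mulrC powRrM.
  by apply: ge0_ler_powR; rewrite ?nnegrE ?powR_ge0 ?(ltW s0) ?(ltW t0).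
have pj := powRS_int j p0.
have /cvgrPdist_le/(_ e e0) H1 := geomratio_powq (j := j) p1 pq.
have /cvgrPdist_le/(_ e e0) H2 := geomratio_powq (j := j + 1) p1 pq.
near=> K.
have G1 : geomratio p q K (q `^ j%:~R) <= geomratio p q K t.
  by apply: geomratio_mono => //; [exact: ltW | exact: powR_ge0].
have G2 : geomratio p q K t <= geomratio p q K (q `^ (j + 1)%:~R).
  by apply: geomratio_mono => //; exact: ltW.
have : `|p `^ j%:~R - geomratio p q K (q `^ j%:~R)| <= e by near: K.
have : `|p `^ (j + 1)%:~R - geomratio p q K (q `^ (j + 1)%:~R)| <= e by near: K.
rewrite !ler_distl => /andP[A1 A2] /andP[A3 A4].
rewrite pj in A1 A2 tu'.
have := ler_wpM2l (_ : 0 <= p - 1) lt'.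
rewrite subr_ge0 (ltW p1) => /(_ isT) B.
apply/andP; split; lra.
Unshelve. all: by end_near.
Qed.
End GeometricSums.

Section Loewner.
Variable (R : realType).

(** The integral of [k] against the finitely supported measure with mass [x.1]
    at the point [x.2], for [x] in [mu]. *)
Definition atomic (mu : seq (R * R)) (k : R -> R) : R :=
  \sum_(x <- mu) x.1 * k x.2.

Definition positive_measure (mu : seq (R * R)) : bool :=
  all (fun x => (0 <= x.1) && (0 < x.2)) mu.

Definition geomatoms (p q : R) (K : nat) : seq (R * R) :=
  [seq (p ^+ k / geomsum p q K 1, q ^+ k / q ^+ K) | k <- iota 0 K.*2.+1].

Lemma atomic_geomatoms (p q t : R) K :
  atomic (geomatoms p q K) (fun l => t / (t + l)) = geomratio p q K t.
Proof.
rewrite /atomic big_map /geomratio /geomsum mulr_suml.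
have -> : iota 0 K.*2.+1 = index_iota 0 K.*2.+1 by rewrite /index_iota subn0.
by rewrite big_mkord; apply: eq_bigr => k _ /=; rewrite mulrAC.
Qed.

Lemma geomatoms_positive (p q : R) K : 0 < p -> 0 < q ->
  positive_measure (geomatoms p q K).
Proof.
move=> p0 q0; apply/allP => _ /mapP[k _ ->] /=.
by rewrite !divr_ge0 ?divr_gt0 ?exprn_ge0 ?exprn_gt0 ?ltW // geomsum1_gt0.
Qed.

(** The limit is taken along a filter on measures because it is iterated: for
    fixed [p] the number of atoms tends to infinity, which determines [t^s] only
    up to a factor [p], and then [p] tends to 1.  A filter gives the usual limit
    arithmetic without extracting a diagonal sequence. *)
Theorem loewner_power (s : R) : 0 < s < 1 ->
  exists2 F : set_system (seq (R * R)), ProperFilter F &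
    (\forall mu \near F, positive_measure mu) /\
    forall t : R, 0 <= t -> (fun mu => atomic mu (fun l => t / (t + l))) @ F --> t `^ s.
Proof.
move=> s01; have [s0 s1] := andP s01.
pose F : set_system (seq (R * R)) := [set S | \forall p \near 1^'+,
  \forall K \near \oo, S (geomatoms p (p `^ s^-1) K)].
have FF : ProperFilter F.
  apply: Build_ProperFilter_ex.
    move=> S /= H; near (1 : R)^'+ => p.
    have Hp : \forall K \near \oo, S (geomatoms p (p `^ s^-1) K) by near: p.
    by near \oo => K; exists (geomatoms p (p `^ s^-1) K); near: K.
  split => /=.
  - by rewrite /F /=; near=> p; near=> K.
  - by move=> A B; rewrite /F /= => HA HB; apply: filterS2 HA HB => p; apply: filterS2 => K.
  - move=> A B AB; rewrite /F /= => HA; apply: filterS HA => p; apply: filterS => K; exact: AB.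
exists F => //; split.
  suff : \forall p \near 1^'+, \forall K \near \oo,
    positive_measure (geomatoms p (p `^ s^-1) K) by [].
  near=> p; near=> K.
  have p0 : 0 < p by apply: lt_trans (_ : 1 < p).
  by apply: geomatoms_positive; last apply: powR_gt0.
move=> t t0; apply/cvgrPdist_le => e e0.
suff : \forall p \near 1^'+, \forall K \near \oo, `|t `^ s -
   atomic (geomatoms p (p `^ s^-1) K) (fun l => t / (t + l))| <= e by [].
have e2 : 0 < e / 2 by rewrite divr_gt0.
near=> p.
have p1 : 1 < p by [].
have : (p - 1) * t `^ s <= e / 2.
  have : p <= 1 + e / 2 / (t `^ s + 1).
    near: p; apply: nbhs_right_le.
    by rewrite ltrDl divr_gt0 // ltr_wpDl ?powR_ge0.
  have c0 := powR_ge0 t s.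
  rewrite -lerBlDl ler_pdivlMr ?ltr_wpDl //; apply: le_trans.
  by rewrite ler_wpM2l ?lerDl // subr_ge0 ltW.
move=> pe; have := geomratio_near p1 s01 t0 e2.
apply: filterS => K; rewrite atomic_geomatoms distrC => /le_trans; apply.
by rewrite [leRHS]splitr lerD2r.
Unshelve. all: by end_near.
Qed.
End Loewner.

(** * Difference quotients of powers *)

Section DividedDifference.
Variable (R : realType).
Implicit Types (r s t l : R).

Definition divdiff r t : R := if t == 1 then r else (1 - t `^ r) / (1 - t).

(** The limit at 1 is the derivative of [t `^ r] there. *)
Lemma divdiff_cont1 r : divdiff r @ (1 : R) --> divdiff r 1.
Proof.
have [dr er] := is_derive1_powR r (@ltr01 R).
have : h^-1 *: (((powR (R := R))^~ r \o shift 1) (h *: 1) - 1 `^ r) @[h --> 0^'] --> r.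
  by rewrite powR1 mulr1 in er; rewrite -[X in _ --> X]er; exact: dr.
move=> /cvgrPdist_le H; apply/cvgrPdist_le => e e0.
have {H} := H e e0; rewrite !near_simpl => -[d /= d0 H].
exists d => //= x /= xd; rewrite /divdiff eqxx; case: eqVneq => [_|x1].
  by rewrite subrr normr0 ltW.
have := H (x - 1); rewrite /= sub0r normrN distrC => /(_ xd).
rewrite subr_eq0 => /(_ x1); congr (`|_ - _| <= _).
rewrite /shift /= !/GRing.scale /= mulr1 subrK powR1.
by field; rewrite !subr_eq0 x1 eq_sym x1.
Qed.

(** The absolute value is there because [t `^ r] is 1 for negative [t], so that
    [powR] alone is not continuous at 0. *)
Lemma powR_norm_continuous r : 0 < r -> continuous (fun t : R => `|t| `^ r).
Proof.
move=> r0 t; have [->|t0] := eqVneq t 0.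
  rewrite /continuous_at normr0 powR0 ?gt_eqF //.
  apply/cvgr0Pnorm_le => e e0.
  near=> x; rewrite ger0_norm ?powR_ge0 //.
  have -> : e = (e `^ r^-1) `^ r by rewrite -powRrM mulVf ?gt_eqF // powRr1 // ltW.
  apply: ge0_ler_powR; rewrite ?nnegrE ?powR_ge0 ?normr_ge0 // ?(ltW r0) //.
  by near: x; apply: cvgr0_norm_le; [exact: cvg_id | exact: powR_gt0].
apply: (@continuous_comp _ _ _ (fun u : R => `|u|) (fun u : R => u `^ r)).
  exact: norm_continuous.
apply: differentiable_continuous; apply/derivable1_diffP.
by apply: derivable_powR; rewrite in_itv /= andbT normr_gt0.
Unshelve. all: by end_near.
Qed.

Lemma divdiff_norm_continuous r : 0 < r -> continuous (fun t : R => divdiff r `|t|).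
Proof.
move=> r0 t; have [t1|t1] := eqVneq `|t| 1.
  apply: (@cvg_comp _ _ _ Num.norm (divdiff r) _ (nbhs (1 : R))).
    by rewrite -t1; exact: norm_continuous.
  by rewrite t1; exact: divdiff_cont1.
have E : (fun u : R => (1 - `|u| `^ r) / (1 - `|u|)) @ t --> divdiff r `|t|.
  rewrite /divdiff (negbTE t1); apply: cvgM.
    by apply: cvgB; [exact: cvg_cst | exact: powR_norm_continuous].
  apply: cvgV; first by rewrite subr_eq0 eq_sym.
  by apply: cvgB; [exact: cvg_cst | exact: norm_continuous].
apply: cvg_trans E; apply: near_eq_cvg; near=> u.
have u1 : `|u| != 1.
  near: u; apply: (@norm_continuous _ _ t [set x : R | x != 1]).
  by apply: open_nbhs_nbhs; split=> //; exact: open_neq.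
by rewrite /divdiff (negbTE u1).
Unshelve. all: by end_near.
Qed.

Lemma divdiffS s t : 0 <= t -> 0 <= s ->
  divdiff (1 + (1 + s)) t = 1 + t * divdiff (1 + s) t.
Proof.
move=> t0 s0; rewrite /divdiff; case: eqVneq => [->|t1]; first by rewrite mul1r.
have -> : t `^ (1 + (1 + s)) = t * t `^ (1 + s).
  by rewrite powRD ?powRr1 // gt_eqF //; lra.
by field; rewrite subr_eq0 eq_sym.
Qed.

(** The difference quotient between [t] and 1 of the function
    [u * (u / (u + l))], extended to [t = 1]; see [loewner_quotientE]. *)
Definition loewner_quotient t l : R := t / (t + l) + l / ((1 + l) * (t + l)).

Lemma loewner_quotientE t l : 0 <= t -> 0 < l -> t != 1 ->
  loewner_quotient t l = (t * (t / (t + l)) - 1 / (1 + l)) / (t - 1).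
Proof.
move=> t0 l0 t1; rewrite /loewner_quotient; field.
by rewrite subr_eq0 t1 !gt_eqF //; lra.
Qed.

Lemma loewner_quotient_mono s t l : 0 <= s -> s <= t -> 0 < l ->
  loewner_quotient s l <= loewner_quotient t l.
Proof.
move=> s0 st l0.
have E u : 0 <= u -> loewner_quotient u l = 1 - l ^+ 2 / (1 + l) / (u + l).
  by move=> u0; rewrite /loewner_quotient; field; rewrite !gt_eqF //; lra.
rewrite !E ?(le_trans s0) // lerD2l lerN2 ler_wpM2l //.
  by rewrite divr_ge0 ?sqr_ge0 //; lra.
by rewrite lef_pV2 ?posrE; lra.
Qed.

Lemma eq_atomic (mu : seq (R * R)) (f g : R -> R) : positive_measure mu ->
  (forall l, 0 < l -> f l = g l) -> atomic mu f = atomic mu g.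
Proof.
move=> /allP pmu fg; apply: eq_big_seq => x /pmu /andP[_ x2].
by rewrite fg.
Qed.

Lemma le_atomic (mu : seq (R * R)) (f g : R -> R) : positive_measure mu ->
  (forall l, 0 < l -> f l <= g l) -> atomic mu f <= atomic mu g.
Proof.
move=> /allP pmu fg; rewrite /atomic !big_seq; apply: ler_sum => x /pmu /andP[x1 x2].
by rewrite ler_wpM2l ?fg.
Qed.

(** Away from [t = 1] this is limit arithmetic.  At [t = 1] the quotients are
    squeezed between their values at [1 - h] and [1 + h], since they are
    increasing in [t], and the limit is continuous at 1. *)
Lemma atomic_quotient_cvg s (F : set_system (seq (R * R))) : 0 < s < 1 ->
  ProperFilter F -> (\forall mu \near F, positive_measure mu) ->
  (forall t, 0 <= t -> (fun mu => atomic mu (fun l => t / (t + l))) @ F --> t `^ s) ->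
  forall t, 0 <= t ->
    (fun mu => atomic mu (loewner_quotient t)) @ F --> divdiff (1 + s) t.
Proof.
move=> /andP[s0 s1] FF pF cF.
have ne1 t : 0 <= t -> t != 1 ->
    (fun mu => atomic mu (loewner_quotient t)) @ F --> divdiff (1 + s) t.
  move=> t0 t1; rewrite /divdiff (negbTE t1).
  have -> : (1 - t `^ (1 + s)) / (1 - t) = (t * t `^ s - 1 `^ s) / (t - 1).
    rewrite powR1 powRD; last by rewrite gt_eqF //; lra.
    by rewrite powRr1 //; field; rewrite !subr_eq0 t1 eq_sym t1.
  have : (fun mu => (t * atomic mu (fun l => t / (t + l))
       - atomic mu (fun l => 1 / (1 + l))) / (t - 1)) @ F
     --> (t * t `^ s - 1 `^ s) / (t - 1).
    apply: cvgM; last exact: cvg_cst.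
    apply: cvgB; last exact: cF.
    by apply: cvgM; [exact: cvg_cst | exact: cF].
  apply: cvg_trans; apply: near_eq_cvg; apply: filterS pF => mu pmu.
  rewrite (eq_atomic pmu (fun l (l0 : 0 < l) => loewner_quotientE t0 l0 t1)).
  rewrite /atomic mulr_sumr -sumrB mulr_suml; apply: eq_bigr => x _; ring.
move=> t t0; have [->|] := eqVneq t 1; last exact: ne1.
apply/cvgrPdist_le => e e0.
have e2 : 0 < e / 2 by rewrite divr_gt0.
have /cvgrPdist_le/(_ _ e2) [d /= d0 Hd] := @divdiff_cont1 (1 + s).
pose h := Num.min (d / 2) (1 / 2).
have hd : h <= d / 2 by rewrite ge_min lexx.
have h2 : h <= 1 / 2 by rewrite ge_min lexx orbT.
have h0 : 0 < h by rewrite lt_min !divr_gt0.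
have /cvgrPdist_le/(_ _ e2) L : (fun mu => atomic mu (loewner_quotient (1 - h))) @ F
    --> divdiff (1 + s) (1 - h).
  by apply: ne1; lra.
have /cvgrPdist_le/(_ _ e2) U : (fun mu => atomic mu (loewner_quotient (1 + h))) @ F
    --> divdiff (1 + s) (1 + h).
  by apply: ne1; lra.
have DL := Hd (1 - h); have DU := Hd (1 + h).
rewrite /= in DL DU.
have {}DL := DL _; have {}DU := DU _.
near=> mu.
have pmu : positive_measure mu by near: mu.
have L1 : atomic mu (loewner_quotient (1 - h)) <= atomic mu (loewner_quotient 1).
  by apply: le_atomic => // l l0; apply: loewner_quotient_mono => //; lra.
have U1 : atomic mu (loewner_quotient 1) <= atomic mu (loewner_quotient (1 + h)).
  by apply: le_atomic => // l l0; apply: loewner_quotient_mono => //; lra.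
have L2 : `|divdiff (1 + s) (1 - h) - atomic mu (loewner_quotient (1 - h))| <= e / 2
  by near: mu.
have U2 : `|divdiff (1 + s) (1 + h) - atomic mu (loewner_quotient (1 + h))| <= e / 2
  by near: mu.
have {}DL : `|divdiff (1 + s) 1 - divdiff (1 + s) (1 - h)| <= e / 2.
  by apply: DL; rewrite opprB addrC subrK gtr0_norm //; lra.
have {}DU : `|divdiff (1 + s) 1 - divdiff (1 + s) (1 + h)| <= e / 2.
  by apply: DU; rewrite opprD addrA subrr sub0r normrN gtr0_norm //; lra.
move: DL DU L2 U2; rewrite !ler_distl => /andP[? ?] /andP[? ?] /andP[? ?] /andP[? ?].
apply/andP; split; lra.
Unshelve. all: by end_near.
Qed.
End DividedDifference.


(** * Functional calculus on conditionally negative definite kernels *)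

Lemma cnd_lim (R : realType) (I : finType) (T : Type) (F : set_system T)
    (K : T -> I -> I -> R) (L : I -> I -> R) : ProperFilter F ->
  (forall i j, (fun a => K a i j) @ F --> L i j) ->
  (\forall a \near F, cnd (K a)) -> cnd L.
Proof.
move=> FF KL cK; split=> [i j|v v0].
  have y : (fun a => K a i j - K a j i) @ F --> L i j - L j i.
    by apply: cvgB; exact: KL.
  have z : (fun a => K a i j - K a j i) @ F --> (0 : R).
    apply: cvg_near_cst; apply: filterS cK => a [sK _]; by rewrite sK subrr.
  by apply/eqP; rewrite -subr_eq0; apply/eqP; exact: cvg_unique y z.
have : (fun a => qform (K a) v) @ F --> qform L v.
  apply: cvg_big => [|i _]; first exact: add_continuous.
  apply: cvg_big => [|j _]; first exact: add_continuous.
  by apply: cvgM; [exact: cvg_cst | exact: KL].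
move=> /cvgr_to_le; apply; apply: filterS cK => a [_]; exact.
Qed.

Section KernelCalculus.
Variables (R : realType) (I : finType).
Implicit Types (h : I -> I -> R).

Lemma cnd_atomic (mu : seq (R * R)) (K : R -> I -> I -> R) : positive_measure mu ->
  (forall l, 0 < l -> cnd (K l)) ->
  cnd (fun i j => atomic mu (fun l => K l i j)).
Proof.
move=> /allP pmu cK.
apply: (eq_cnd (K := fun i j => \sum_(x <- mu | x \in mu) x.1 * K x.2 i j)).
  by move=> i j; rewrite /atomic big_seq.
by apply: cnd_sum => x /pmu /andP[x1 x2]; apply: cndZ => //; exact: cK.
Qed.

Lemma cnd_powR h s : cnd h -> (forall i j, 0 <= h i j) -> 0 < s <= 1 ->
  cnd (fun i j => h i j `^ s).
Proof.
move=> ch h0 /andP[s0]; rewrite le_eqVlt => /predU1P[->|s1].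
  by apply: eq_cnd ch => i j; rewrite powRr1.
have [|F FF [pF cF]] := @loewner_power R s; first by rewrite s0.
apply: (cnd_lim FF (fun i j => cF (h i j) (h0 i j))).
apply: filterS pF => mu pmu; apply: cnd_atomic => // l l0; exact: cnd_resolvent.
Qed.

Lemma cnd_sqrt h : cnd h -> (forall i j, 0 <= h i j) ->
  cnd (fun i j => Num.sqrt (h i j)).
Proof.
move=> ch h0; apply: (eq_cnd (K := fun i j => h i j `^ 2^-1)).
  by move=> i j; rewrite powR12_sqrt.
by apply: cnd_powR => //; apply/andP; split; lra.
Qed.

Lemma cnd_loewner_quotient h l : cnd h -> (forall i j, 0 <= h i j) -> 0 < l ->
  cnd (fun i j => loewner_quotient (h i j) l).
Proof.
move=> ch h0 l0.
have ll : 0 <= l / (1 + l) by rewrite divr_ge0 //; lra.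
apply: eq_cnd (cndD (cnd_const I (1 / (1 + l))) (cndZ ll (cnd_resolvent ch h0 l0))) => i j.
by rewrite /loewner_quotient; field; rewrite !gt_eqF // ?ltr_wpDl //; lra.
Qed.

Lemma cnd_divdiff_1_2 h r : cnd h -> (forall i j, 0 <= h i j) -> 1 <= r <= 2 ->
  cnd (fun i j => divdiff r (h i j)).
Proof.
move=> ch h0 /andP[]; rewrite le_eqVlt => /predU1P[<- _|r1].
  apply: eq_cnd (cnd_const I 1) => i j; rewrite /divdiff; case: eqVneq => // t1.
  by rewrite powRr1 // divff // subr_eq0 eq_sym.
rewrite le_eqVlt => /predU1P[->|r2].
  apply: eq_cnd (cndD (cnd_const I 1) ch) => i j; rewrite /divdiff.
  case: eqVneq => [->//|t1]; rewrite powR_mulrn //; field.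
  by rewrite subr_eq0 eq_sym.
have s01 : 0 < r - 1 < 1 by apply/andP; split; lra.
have [F FF [pF cF]] := loewner_power s01.
have H := atomic_quotient_cvg s01 FF pF cF.
apply: (cnd_lim (K := fun mu i j => atomic mu (loewner_quotient (h i j))) FF).
  by move=> i j; rewrite -[r](subrK 1) addrC; exact: H.
apply: filterS pF => mu pmu; apply: cnd_atomic => // l l0.
exact: cnd_loewner_quotient.
Qed.

(** [h / (sqrt h + l) + l] is the difference quotient of [u^(3/2)] between [h]
    and [l^2], hence equals [l * divdiff (3/2) (h / l^2)]. *)
Lemma cnd_sqrt_resolvent h l : cnd h -> (forall i j, 0 <= h i j) -> 0 < l ->
  cnd (fun i j => h i j / (Num.sqrt (h i j) + l)).
Proof.
move=> ch h0 l0.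
have l2 : 0 <= l ^- 2 by rewrite invr_ge0 sqr_ge0.
have H : cnd (fun i j => divdiff (3 / 2) (l ^- 2 * h i j)).
  apply: cnd_divdiff_1_2; first exact: cndZ.
    by move=> i j; rewrite mulr_ge0.
  by apply/andP; split; lra.
apply: eq_cnd (cndD (cnd_const I (- l)) (cndZ (ltW l0) H)) => i j.
set u := Num.sqrt (h i j); have u0 : 0 <= u by exact: sqrtr_ge0.
have -> : h i j = u ^+ 2 by rewrite sqr_sqrtr.
have -> : l ^- 2 * u ^+ 2 = (u / l) ^+ 2 by rewrite exprMn exprVn mulrC.
have v0 : 0 <= u / l by rewrite divr_ge0 // ltW.
have -> : u = l * (u / l) by rewrite mulrC divfK // gt_eqF.
move: (u / l) v0 => v v0; rewrite [l * v]mulrC mulfK ?gt_eqF //.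
have vl : v * l + l != 0 by rewrite gt_eqF // ltr_wpDl // mulr_ge0 // ltW.
have -> : divdiff (3 / 2) (v ^+ 2) = if v == 1 then 3 / 2 else
    (1 - (v ^+ 2) `^ (3 / 2)) / (1 - v ^+ 2).
  by rewrite /divdiff -[X in _ == X](expr1n _ 2) eqrXn2.
case: eqVneq => [->|v1].
  by field; rewrite !gt_eqF //; lra.
have -> : (v ^+ 2) `^ (3 / 2) = v ^+ 3.
  rewrite -powR_mulrn // -powRrM -[RHS]powR_mulrn //; congr (_ `^ _); by field.
have v2 : 1 - v ^+ 2 != 0.
  have -> : 1 - v ^+ 2 = (1 - v) * (1 + v) by ring.
  apply: mulf_neq0; first by rewrite subr_eq0 eq_sym.
  by apply: lt0r_neq0; lra.
by field; rewrite vl v2.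
Qed.

(** For [r = 2 + s] and [t = sqrt h], each term of the approximation of
    [divdiff r t = 1 + t * divdiff (1 + s) t] is
    [t^2 / (t + l) + l / (1 + l) * (t / (t + l))]. *)
Lemma cnd_divdiff_sqrt h r : cnd h -> (forall i j, 0 <= h i j) -> 1 <= r <= 3 ->
  cnd (fun i j => divdiff r (Num.sqrt (h i j))).
Proof.
move=> ch h0 /andP[r1 r3].
have cs := cnd_sqrt ch h0; have s0 i j := sqrtr_ge0 (h i j).
have [r2|r2] := leP r 2; first by apply: cnd_divdiff_1_2 => //; rewrite r1.
pose s := r - 2.
have rE : r = 1 + (1 + s) by rewrite /s; ring.
have sg : 0 < s by rewrite /s; lra.
apply: (eq_cnd (K := fun i j => 1 + Num.sqrt (h i j) * divdiff (1 + s) (Num.sqrt (h i j)))).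
  by move=> i j; rewrite rE divdiffS // ltW.
apply: cndD; first exact: cnd_const.
move: r3; rewrite le_eqVlt => /predU1P[r3|r3].
  apply: eq_cnd (cndD cs ch) => i j; have -> : 1 + s = 2 by rewrite /s r3; ring.
  have {2}-> : h i j = Num.sqrt (h i j) ^+ 2 by rewrite sqr_sqrtr.
  move: (Num.sqrt _) (s0 i j) => t t0.
  rewrite /divdiff; case: eqVneq => [->|t1]; first by ring.
  by rewrite powR_mulrn //; field; rewrite subr_eq0 eq_sym.
have s01 : 0 < s < 1 by rewrite sg /s; lra.
have [F FF [pF cF]] := loewner_power s01.
have H := atomic_quotient_cvg s01 FF pF cF.
apply: (cnd_lim (K := fun mu i j => Num.sqrt (h i j) *
    atomic mu (loewner_quotient (Num.sqrt (h i j)))) FF).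
  by move=> i j; apply: cvgM; [exact: cvg_cst | exact: H].
apply: filterS pF => mu pmu.
pose K l i j := Num.sqrt (h i j) * loewner_quotient (Num.sqrt (h i j)) l.
apply: (eq_cnd (K := fun i j => atomic mu (fun l => K l i j))).
  by move=> i j; rewrite /atomic mulr_sumr; apply: eq_bigr => x _; rewrite mulrCA.
apply: cnd_atomic => // l l0.
have ll : 0 <= l / (1 + l) by rewrite divr_ge0 //; lra.
apply: eq_cnd (cndD (cnd_sqrt_resolvent ch h0 l0) (cndZ ll (cnd_resolvent cs s0 l0))) => i j.
rewrite /K /loewner_quotient.
have {1}-> : h i j = Num.sqrt (h i j) ^+ 2 by rewrite sqr_sqrtr.
move: (Num.sqrt _) (s0 i j) => t t0.
by field; rewrite !gt_eqF //; lra.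
Qed.

(** Conditional negative definiteness is preserved by exponents at most 1, so the
    power [- a] is obtained as the [n]-th Schur power of [1 / h^(a/n)]. *)
Lemma cnd_powRN_psd h a : cnd h -> (forall i j, 0 < h i j) -> 0 < a ->
  psd (fun i j => h i j `^ (- a)).
Proof.
move=> ch h0 a0.
pose n := (Num.truncn a).+1.
have na : a <= n%:R by rewrite ltW // Num.Theory.truncnS_gt.
have n0 : (0 : R) < n%:R by rewrite ltr0n.
have b : 0 < a / n%:R <= 1 by rewrite divr_gt0 // ler_pdivrMr // mul1r.
have cb := cnd_powR ch (fun i j => ltW (h0 i j)) b.
have := psd_exp n (cnd_inv_psd cb (fun i j => powR_gt0 _ (h0 i j))).
apply: eq_psd => i j.
by rewrite exprVn -powR_mulrn ?powR_ge0 // -powRrM divfK ?gt_eqF // powRN.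
Qed.
End KernelCalculus.

(** * The Euclidean norm: sufficiency and infinite divisibility *)

Section Euclidean.
Variables (R : realType) (n : nat).
Implicit Types (r t : R) (x y : 'rV[R]_n).

Lemma enorm_ge0 x : 0 <= enorm x. Proof. exact: sqrtr_ge0. Qed.

Lemma enorm_continuous : continuous (@enorm R n).
Proof.
have csum : continuous (fun x : 'rV[R]_n => \sum_(i < n) x 0 i ^+ 2).
  apply: continuous_big => [|i _ x]; first exact: add_continuous.
  apply: (@continuous_comp _ _ _ (fun x : 'rV[R]_n => x 0 i) (fun u : R => u ^+ 2)).
    exact: coord_continuous.
  exact: exprn_continuous.
by move=> x; apply: continuous_comp; [exact: csum | exact: sqrt_continuous].
Qed.

Lemma g_fun_continuous r : 0 < r -> continuous (@g_fun R n r).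
Proof.
move=> r0; have -> : @g_fun R n r = (fun t => divdiff r `|t|) \o @enorm R n.
  by apply/funext => x; rewrite /= ger0_norm ?enorm_ge0.
move=> x; apply: continuous_comp; first exact: enorm_continuous.
exact: divdiff_norm_continuous.
Qed.

Lemma cnd_sqr_enorm (I : finType) (x : I -> 'rV[R]_n) :
  cnd (fun i j => enorm (x i - x j) ^+ 2).
Proof.
apply: (eq_cnd (K := fun i j => \sum_(k < n) (x i 0 k - x j 0 k) ^+ 2)).
  move=> i j; rewrite sqr_sqrtr; last by apply: sumr_ge0 => k _; exact: sqr_ge0.
  by apply: eq_bigr => k _; rewrite !mxE.
by apply: cnd_sum => k _; exact: (cnd_sqr_dist (fun i => x i 0 k)).
Qed.

Lemma cnd_g_fun (I : finType) r (x : I -> 'rV[R]_n) : 1 <= r <= 3 ->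
  cnd (fun i j => g_fun r (x i - x j)).
Proof.
move=> r13; apply: eq_cnd (cnd_divdiff_sqrt (cnd_sqr_enorm x) _ r13) => i j.
  by rewrite sqrtr_sqr ger0_norm ?enorm_ge0.
exact: sqr_ge0.
Qed.

Lemma quad_formE m (A : 'M[R]_m) v :
  quad_form A v = qform (fun i j => A i j) (fun i => v i 0).
Proof.
rewrite /quad_form mxE; apply: eq_bigr => i _; rewrite !mxE mulr_sumr.
by apply: eq_bigr => j _; rewrite [A i j * _]mulrC mulrA.
Qed.

Lemma symmetricmxP m (A : 'M[R]_m) :
  A \is symmetricmx <-> forall i j, A i j = A j i.
Proof.
split=> [/is_hermitianmxP e i j|e].
  by rewrite {1}e expr0 scale1r !mxE.
by apply/is_hermitianmxP; rewrite expr0 scale1r; apply/matrixP => i j; rewrite !mxE.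
Qed.

Lemma psdmxP m (A : 'M[R]_m) : psdmx A <-> psd (fun i j => A i j).
Proof.
split=> -[sA pA].
  split=> [|v]; first exact/symmetricmxP.
  have := pA (\col_i v i); rewrite quad_formE; congr (_ <= _).
  by apply: eq_bigr => i _; apply: eq_bigr => j _; rewrite !mxE.
by split=> [|v]; [exact/symmetricmxP | rewrite quad_formE].
Qed.

Lemma cndmxP m (A : 'M[R]_m) : cndmx A <-> cnd (fun i j => A i j).
Proof.
have qN (v : 'cV[R]_m) : quad_form (- A) v = - quad_form A v.
  by rewrite /quad_form mulNmx mulmxN mxE.
split=> -[sA pA].
  split=> [i j|v v0].
    by have /symmetricmxP/(_ i j) := sA; rewrite !mxE => /oppr_inj.
  have := pA (\col_i v i); rewrite qN oppr_ge0 quad_formE.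
  have -> : \sum_j (\col_i v i) j 0 = 0.
    by rewrite -[RHS]v0; apply: eq_bigr => i _; rewrite mxE.
  move=> /(_ erefl); congr (_ <= _).
  by apply: eq_bigr => i _; apply: eq_bigr => j _; rewrite !mxE.
split=> [|v v0]; first by apply/symmetricmxP => i j; rewrite !mxE sA.
by rewrite qN oppr_ge0 quad_formE pA.
Qed.

Lemma g_fun_cond_negative_definite r : 1 <= r <= 3 ->
  cond_negative_definite (@g_fun R n r).
Proof.
move=> r13; split; first by apply: g_fun_continuous; case/andP: r13; lra.
move=> m x _; apply/cndmxP; apply: eq_cnd (cnd_g_fun x r13) => i j.
by rewrite mxE.
Qed.

Lemma divdiff_gt0 r t : 0 < r -> 0 <= t -> 0 < divdiff r t.
Proof.
move=> r0 t0; rewrite /divdiff; case: eqVneq => // t1.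
have [lt1|gt1] : t < 1 \/ 1 < t by apply/orP; rewrite -neq_lt.
  have := gt0_ltr_powR r0 t0 ler01 lt1; rewrite powR1 => tr.
  by rewrite divr_gt0 ?subr_gt0.
have := gt0_ltr_powR r0 ler01 t0 gt1; rewrite powR1 => tr.
by rewrite -mulrNN -invrN divr_gt0 // oppr_gt0 subr_lt0.
Qed.

Lemma f_funE r x : f_fun r x = (g_fun r x)^-1.
Proof. by rewrite /f_fun /g_fun; case: ifP => // _; rewrite invf_div. Qed.

Lemma f_fun_infinitely_divisible r : 1 <= r <= 3 ->
  infinitely_divisible (@f_fun R n r).
Proof.
move=> r13; have r0 : 0 < r by case/andP: r13; lra.
have g0 x : 0 < g_fun r x by exact: divdiff_gt0 (enorm_ge0 x).
split=> [x|a a0]; first by rewrite f_funE invr_ge0 ltW.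
have fE x : f_fun r x `^ a = g_fun r x `^ (- a).
  by rewrite f_funE -powR_inv1 ?ltW // -powRrM mulN1r.
split.
  have -> : (fun x => f_fun r x `^ a) = (fun u : R => u `^ (- a)) \o @g_fun R n r.
    by apply/funext => x; rewrite /= fE.
  move=> x; apply: continuous_comp; first exact: g_fun_continuous.
  apply: differentiable_continuous; apply/derivable1_diffP.
  by apply: derivable_powR; rewrite in_itv /= andbT.
move=> m x _; apply/psdmxP.
have := cnd_powRN_psd (cnd_g_fun x r13) (fun i j => g0 (x i - x j)) a0.
by apply: eq_psd => i j; rewrite mxE fE.
Qed.
End Euclidean.

(** * Necessity of the bounds on the exponent *)

Section Necessity.
Variables (R : realType).
Implicit Types (r t : R).

Lemma divdiff0 r : 0 < r -> divdiff r 0 = 1.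
Proof.
move=> r0; rewrite /divdiff eq_sym oner_eq0 powR0 ?gt_eqF //.
by rewrite subr0 divff ?oner_neq0.
Qed.

(** Necessity is tested on the points of a coordinate axis, where the Euclidean
    norm is the absolute value. *)
Lemma divdiff_cnd_line n m r (a : 'I_m.+1 -> R) : (1 <= n)%N ->
  cond_negative_definite (@g_fun R n r) ->
  cnd (fun i j => divdiff r `|a i - a j|).
Proof.
case: n => // n _ [_ cg].
pose x i : 'rV[R]_n.+1 := a i *: delta_mx 0 0.
have enE u : enorm (u *: delta_mx 0 0 : 'rV[R]_n.+1) = `|u|.
  rewrite -sqrtr_sqr; congr Num.sqrt; rewrite (bigD1 ord0) //= !mxE !eqxx mulr1.
  by rewrite big1 ?addr0 // => i /negbTE ne; rewrite !mxE ne andbF mulr0 expr0n.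
have /cndmxP := cg m.+1 x isT.
by apply: eq_cnd => i j; rewrite mxE /g_fun /x -scalerBl enE.
Qed.

(** The test at [0, t, 2 t] with weights [1, -2, 1]. *)
Lemma cnd_second_difference r t : 0 < r -> 0 <= t ->
  cnd (fun i j : 'I_3 => divdiff r `|(i%:R * t) - (j%:R * t)|) ->
  divdiff r (2 * t) - 1 <= 4 * (divdiff r t - 1).
Proof.
move=> r0 t0 [_ c3].
have := c3 (fun i => [:: 1; - 2; 1]`_i).
rewrite /qform !big_ord_recl !big_ord0 /=.
rewrite !(mul0r, mul1r, subrr, normr0, sub0r, subr0, divdiff0) //.
have -> : bump 0 (bump 0 0) = 2%N by [].
have e1 : t - 2%:R * t = - t by ring.
have e2 : 2%:R * t - t = t by ring.
have t2 : 0 <= 2%:R * t by rewrite mulr_ge0.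
rewrite e1 e2 !normrN !ger0_norm // => H.
have : 1 + (-2 + (1 + 0)) = 0 :> R by ring.
by move=> /H; lra.
Qed.

Lemma divdiff_dyadic_le r k :
  (forall t, 0 <= t -> divdiff r (2 * t) - 1 <= 4 * (divdiff r t - 1)) ->
  divdiff r (2 ^+ k) - 1 <= 4 ^+ k * (r - 1).
Proof.
move=> H; elim: k => [|k IH].
  by rewrite !expr0 mul1r /divdiff eqxx.
rewrite !exprS -mulrA; apply: le_trans (H _ _) _; first exact: exprn_ge0.
by rewrite ler_wpM2l.
Qed.

Lemma divdiff_growth r t : 1 <= r -> 1 < t -> t `^ (r - 1) - 1 <= divdiff r t - 1.
Proof.
move=> r1 t1; rewrite /divdiff gt_eqF //.
have t0 : 0 < t by lra.
have -> : t `^ r = t * t `^ (r - 1) by rewrite mulr_powRB1 //; lra.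
have c1 : 1 <= t `^ (r - 1).
  by rewrite -[leLHS](powRr0 t) ler_powR; lra.
move: (_ `^ _) c1 => c c1.
rewrite lerD2r -mulrNN -invrN !opprB ler_pdivlMr; nra.
Qed.

Lemma cond_negative_definite_exponent n r : (1 <= n)%N -> 0 < r ->
  cond_negative_definite (@g_fun R n r) -> 1 <= r <= 3.
Proof.
move=> n1 r0 cg.
have r1 : 1 <= r.
  have := cnd_diag_le ord0 ord_max (divdiff_cnd_line (fun i : 'I_2 => i%:R) n1 cg).
  by rewrite /= !subrr sub0r normrN normr0 normr1 divdiff0 // /divdiff eqxx; lra.
rewrite r1 /=; have [//|r3] := leP r 3.
have H k : divdiff r (2 ^+ k) - 1 <= 4 ^+ k * (r - 1).
  apply: divdiff_dyadic_le => // t t0; apply: cnd_second_difference => //.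
  exact: (divdiff_cnd_line (fun i : 'I_3 => i%:R * t) n1 cg).
(* [T = 2 ^+ k >= b] makes [T^(r-3) >= r + 1], against the bound
   [T^(r-1) - 1 <= T^2 (r - 1)] *)
pose b := (r + 1) `^ (r - 3)^-1.
pose k := (Num.truncn b).+1.
have bk : b <= 2 ^+ k.
  apply: (@le_trans _ _ k%:R); first by rewrite ltW // Num.Theory.truncnS_gt.
  by rewrite -natrX ler_nat ltnW // ltn_expl.
have T1 : 1 < (2 : R) ^+ k by rewrite exprn_egt1 // ltr1n.
have := le_trans (divdiff_growth r1 T1) (H k).
have -> : (4 : R) ^+ k = (2 ^+ k) ^+ 2 by rewrite -exprM mulnC exprM; congr (_ ^+ _); ring.
move: (2 ^+ k) T1 bk => T T1 bT.
have -> : T `^ (r - 1) = T ^+ 2 * T `^ (r - 3).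
  rewrite -powR_mulrn; last by lra.
  rewrite -powRD; last by rewrite (gt_eqF (lt_trans ltr01 T1)) implybT.
  by congr (_ `^ _); ring.
have c : r + 1 <= T `^ (r - 3).
  have -> : r + 1 = b `^ (r - 3).
    by rewrite /b -powRrM mulVf ?powRr1 //; [lra | rewrite gt_eqF //; lra].
  by apply: ge0_ler_powR; rewrite ?nnegrE ?powR_ge0 //; lra.
move: (_ `^ _) c => c c1 c2.
have T2 : 1 <= T ^+ 2 by rewrite exprn_ege1 // ltW.
nra.
Qed.
End Necessity.

Theorem theorem1p2 (R : realType) (n : nat) (r : R) (hn : (1 <= n)%N)
    (hr : 0 < r) :
  (cond_negative_definite (@g_fun R n r) <-> 1 <= r <= 3) /\
  (1 <= r <= 3 -> infinitely_divisible (@f_fun R n r)).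
Proof.
split; last exact: f_fun_infinitely_divisible.
split; first exact: cond_negative_definite_exponent.
exact: g_fun_cond_negative_definite.
Qed.
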